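(* Let $X$ be an irreducible shift space which is eventually dendric with threshold $m$. Then for every $w\in\mathcal L(X)$ the set $\mathcal R_X(w)$ is finite. Moreover, for every $w\in\mathcal L_{\ge m}(X)$, $$\mathrm{Card}\,\mathcal R_X(w)=1+\rho_X(\mathcal L_m(X)).$$
   Context: $A$ is a finite alphabet; a shift space is a closed shift-invariant subset $X\subseteq A^{\mathbb Z}$; $\mathcal L(X)$ is its set of finite factors (including the empty word), $\mathcal L_n(X)=\mathcal L(X)\cap A^n$, $\mathcal L_{\ge n}(X)=\bigcup_{k\ge n}\mathcal L_k(X)$. $X$ is irreducible if for all $u,v\in\mathcal L(X)$ there is $w$ with $uwv\in\mathcal L(X)$. For $w\in\mathcal L(X)$, the extension graph $\mathcal E_1(w)$ is the undirected bipartite graph with vertex set the disjoint union of $\{a\in A: aw\in\mathcal L(X)\}$ and $R_1(w)=\{b\in A: wb\in\mathcal L(X)\}$, with an edge $(a,b)$ iff $awb\in\mathcal L(X)$; $X$ is eventually dendric with threshold $m$ if $\mathcal E_1(w)$ is a tree for every $w\in\mathcal L_{\ge m}(X)$. $\rho_X(w)=\mathrm{Card}\,R_1(w)-1$ and $\rho_X(W)=\sum_{w\in W}\rho_X(w)$. A complete return word to $w$ is a word of $\mathcal L(X)$ having exactly two factors equal to $w$, one as a proper prefix and one as a proper suffix; $\mathcal R_X(w)$, the set of (right) return words to $w$, is the set of words $u$ such that $wu$ is a complete return word to $w$. *)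

(* Defs.v *)
From HB Require Import structures.
From mathcomp Require Import all_boot all_order all_algebra.
From Stdlib Require Import Relations ClassicalEpsilon.
Set Implicit Arguments. Unset Strict Implicit. Unset Printing Implicit Defensive.
Import Order.TTheory GRing.Theory Num.Theory.
Local Open Scope ring_scope.

Definition decP (P : Prop) : bool :=
  if excluded_middle_informative P then true else false.

Section Shift.
Variable A : finType.

Definition config := int -> A.

Definition shift (x : config) : config := fun i => x (i + 1).

(* closed in the product topology: a configuration all of whose finite central
   windows are matched by points of X lies in X *)
Definition closedX (X : config -> Prop) : Prop :=
  forall x : config,
    (forall n : nat, exists y, X y /\ forall i : int, (absz i <= n)%N -> y i = x i) ->
    X x.

(* shift-invariant: sigma(X) = X (sigma is a bijection) *)
Definition shift_invariant (X : config -> Prop) : Prop :=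
  forall x, X x <-> X (shift x).

Definition shift_space (X : config -> Prop) : Prop :=
  closedX X /\ shift_invariant X.

Definition occurs (x : config) (u : seq A) : Prop :=
  exists i : int, [seq x (i + k%:Z) | k <- iota 0 (size u)] = u.

Definition lang (X : config -> Prop) (u : seq A) : Prop :=
  exists x, X x /\ occurs x u.

Definition irreducible (X : config -> Prop) : Prop :=
  forall u v, lang X u -> lang X v -> exists w, lang X (u ++ w ++ v).

Definition ext_vertex (X : config -> Prop) (w : seq A) (v : A + A) : Prop :=
  match v with
  | inl a => lang X (a :: w)
  | inr b => lang X (rcons w b)
  end.

Definition ext_edge (X : config -> Prop) (w : seq A) (u v : A + A) : Prop :=
  ext_vertex X w u /\ ext_vertex X w v /\
  match u, v with
  | inl a, inr b => lang X (a :: rcons w b)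
  | inr b, inl a => lang X (a :: rcons w b)
  | _, _ => False
  end.

End Shift.

(* a (simple undirected) graph with vertex predicate V and symmetric edge
   relation E is a tree: connected and without cycles *)
Definition is_tree (T : eqType) (V : T -> Prop) (E : T -> T -> Prop) : Prop :=
  (forall u v, V u -> V v -> clos_refl_trans T E u v) /\
  ~ (exists (c : seq T) (x0 : T), uniq c /\ (3 <= size c)%N /\
       forall i, (i < size c)%N -> E (nth x0 c i) (nth x0 c (i.+1 %% size c))).

Section Shift2.
Variable A : finType.

Definition eventually_dendric (X : config A -> Prop) (m : nat) : Prop :=
  forall w : seq A, lang X w -> (m <= size w)%N ->
    is_tree (ext_vertex X w) (ext_edge X w).

Definition R1 (X : config A -> Prop) (w : seq A) : {set A} :=
  [set b | decP (lang X (rcons w b))].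

Definition rho (X : config A -> Prop) (w : seq A) : int := (#|R1 X w|%:Z - 1).

Definition rho_Lm (X : config A -> Prop) (m : nat) : int :=
  \sum_(t : m.-tuple A | decP (lang X t)) rho X t.

Definition n_occ (w v : seq A) : nat :=
  count (fun i => (i + size w <= size v)%N && (take (size w) (drop i v) == w))
        (iota 0 (size v).+1).

Definition complete_return (X : config A -> Prop) (w v : seq A) : Prop :=
  lang X v /\ n_occ w v = 2%N /\
  prefix w v /\ suffix w v /\ (size w < size v)%N.

Definition return_word (X : config A -> Prop) (w u : seq A) : Prop :=
  complete_return X w (w ++ u).

End Shift2.

(* Main.v *)
(** Fix [w] of length at least [m]. Call a word of the language open if it starts with [w]
    and contains no other occurrence of [w]. The children [p b] of an open word [p] are
    either open or complete return words to [w], so that counting by length, with [o_k] open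
    words and [r_k] return words at level [k],
        [o_(k+1) + r_(k+1) = o_k + sum of rho over the open words at level k].
    Since a tree has one vertex more than edges, [rho p] is the sum of the [rho (a p)] for
    [size p >= m]. Hence [rho (L_n)] does not depend on [n >= m], and, sorting the words of
    [L_n] by their last occurrence of [w], the sum of [rho] over the open words of length at
    most [n] is the sum of [rho] over the words of [L_n] that contain [w]. So
        [r_1 + ... + r_(K+1) + o_(K+1) = 1 + rho {z in L_(size w + K) | w occurs in z}],
    which is at most [1 + rho (L_m)]. Therefore [r_k] vanishes for large [k]; by
    irreducibility every open word extends to a complete return word and every word avoiding
    [w] is a suffix of an open word, so for large [K] also [o_(K+1) = 0] and all words of
    [L_(size w + K)] contain [w], and the bound is attained. *)

From Stdlib Require Import Relations ClassicalEpsilon.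
From HB Require Import structures.
From mathcomp Require Import all_boot all_order all_algebra zify.
Require Import Defs.
Set Implicit Arguments. Unset Strict Implicit. Unset Printing Implicit Defensive.
Import Order.TTheory GRing.Theory Num.Theory.
Local Open Scope ring_scope.

Lemma decPP (P : Prop) : reflect P (decP P).
Proof. by rewrite /decP; case: excluded_middle_informative => h; constructor. Qed.

(** * Edge count of finite trees *)

Section FiniteTrees.
Variables (T : finType) (e : rel T).
Hypothesis (e_sym : symmetric e) (e_irr : irreflexive e).
Hypothesis e_acyclic : forall c, uniq c -> (3 <= size c)%N -> ~~ cycle e c.

Let restr (V : {set T}) : rel T := [rel x y | [&& x \in V, y \in V & e x y]].

(** Without a leaf, any simple path could be prolonged at its head: the head has a neighbour other
    than the next vertex, and this neighbour is new because a repetition would close a cycle. The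
    path would outgrow [T]. *)
Lemma leaf_exists (V : {set T}) (x : T) : x \in V ->
  (forall y, y \in V -> exists2 z, z \in V & e y z) ->
  exists y z, [/\ y \in V, z \in V, e y z &
                  forall z', z' \in V -> e y z' -> z' = z].
Proof.
move=> xV deg_gt0.
case: (decPP (exists y z, [/\ y \in V, z \in V, e y z &
                  forall z', z' \in V -> e y z' -> z' = z])) => // noleaf.
have deg_gt1 y z : y \in V -> z \in V -> e y z ->
    exists z', [/\ z' \in V, e y z' & z' != z].
  move=> yV zV eyz; case: (decPP (exists z', [/\ z' \in V, e y z' & z' != z])) => // h.
  case: noleaf; exists y, z; split=> // z' z'V eyz'; apply/eqP/negPn/negP => ne.
  by case: h; exists z'.
have long n : exists y p, [/\ y \in V, all (mem V) p, uniq (y :: p),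
    path e y p & size p = n].
  elim: n => [|n [y [p [yV pV up ep sp]]]]; first by exists x, [::].
  (* For empty [p] the default [y] of [head] is harmless, as [e] is irreflexive. *)
  have [z [zV eyz zp]] : exists z, [/\ z \in V, e y z & z != head y p].
    case: p pV up ep sp => [|z p] /= pV up ep sp.
      have [z zV eyz] := deg_gt0 _ yV; exists z; split=> //.
      by apply/eqP => zy; rewrite zy e_irr in eyz.
    by case/andP: pV => zV _; case/andP: ep => eyz _; apply: deg_gt1.
  exists z, (y :: p); split; rewrite //= ?yV ?(e_sym z y) ?eyz ?sp //.
  rewrite [X in _ && X]up andbT inE negb_or; apply/andP; split.
    by apply/eqP => zy; rewrite zy e_irr in eyz.
  apply/negP => zinp; case/splitPr: zinp up ep zp => p1 p2 up ep zp.
  (* The path from [y] to [z] closes up with the edge [e y z]; it has at least three vertices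
     because [z] is not the head of [p]. *)
  have uc : uniq (y :: rcons p1 z).
    by move: up; rewrite -cat_rcons -cat_cons cat_uniq => /and3P[].
  case: p1 uc up ep zp => [|y1 p1] uc up ep zp; first by rewrite eqxx in zp.
  have := e_acyclic uc; rewrite /= size_rcons => /(_ isT) /negP; apply.
  move: ep; rewrite -cat_rcons cat_path rcons_cons /= => /andP[/andP[-> ep] _] /=.
  by rewrite rcons_path ep last_rcons e_sym.
have [y [p [_ _ up _ sp]]] := long #|T|.
by have := uniq_leq_size up (s2 := enum T) (fun z _ => mem_enum T z);
  rewrite -cardE /= sp ltnn.
Qed.

(** The double sum sees each edge twice, so this is twice the identity edges + 1 = vertices.
    Removing a leaf costs one vertex and one edge. *)
Lemma tree_edge_count (V : {set T}) : V != set0 ->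
  (forall x y, x \in V -> y \in V -> connect (restr V) x y) ->
  ((\sum_(x in V) \sum_(y in V) e x y).+2 = #|V|.*2)%N.
Proof.
elim: {V}_.+1 {-2}V (ltnSn #|V|) => // n IH V leV /set0Pn[x xV] conn.
have [V1|] := boolP (V == [set x]).
  by rewrite (eqP V1) cards1 !big_set1 e_irr.
rewrite eqEsubset sub1set xV andbT => /subsetPn[x' x'V]; rewrite inE => x'x.
have [||y [z [yV zV eyz yP]]] := @leaf_exists V x => //.
  move=> y yV; have [t tV ty] : exists2 t, t \in V & t != y.
    by have [->|?] := eqVneq y x; [exists x'|exists x; rewrite // eq_sym].
  case/connectP: (conn _ _ yV tV) ty => [[|s p]] /=; first by move=> _ ->; rewrite eqxx.
  by case/andP=> /and3P[_ sV eys] _ _ _; exists s.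
have zy : z != y by apply/eqP => zy; rewrite zy e_irr in eyz.
have sumy : (\sum_(t in V) e y t = 1)%N.
  rewrite (bigD1 z) //= eyz big1 // => t /andP[tV tz].
  by case: (boolP (e y t)) => // /(yP _ tV) tz'; rewrite tz' eqxx in tz.
have cV : #|V| = #|V :\ y|.+1 by rewrite (cardsD1 y) yV.
rewrite cV doubleS -(IH (V :\ y)); first last.
- move=> u v; rewrite !inE => /andP[uy uV] /andP[vy vV].
  case/connectP: (conn _ _ uV vV) => p /shortenP[q eq uq _] {p} vE; subst v.
  (* A simple path through the leaf [y] would enter and leave it by its only neighbour [z], visiting
     [z] twice. So the path survives the removal of [y]. *)
  apply/connectP; exists q => //; have yq : y \notin q.
    apply/negP => /splitPr yq; case: yq eq uq vy {vV} => q1 [|s q2] eq uq vy.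
      by rewrite last_cat /= eqxx in vy.
    move: eq; rewrite cat_path /= => /and4P[_ /and3P[pV _ epy] /and3P[_ sV eys] _].
    move: uq; rewrite -cat_cons lastI cat_rcons cat_uniq => /and3P[_ _] /= /andP[].
    rewrite !inE !negb_or => /and3P[_ ns _] _; case/eqP: ns.
    by rewrite (yP s sV eys) (yP _ pV) // e_sym.
  elim: q u uy uV eq yq {uq vy vV} => //= s q IHq u uy uV /andP[/and3P[_ sV eus] eq].
  rewrite inE negb_or eq_sym => /andP[sy yq].
  by rewrite /restr /= !inE uy uV sy sV eus; apply: IHq.
- by apply/set0Pn; exists z; rewrite !inE zy.
- by rewrite -ltnS -cV.
rewrite (bigD1 y) //= sumy.
have -> : (\sum_(i in V | i != y) \sum_(j in V) e i j =
   \sum_(i in V :\ y) \sum_(j in V :\ y) e i j + \sum_(i in V | i != y) e y i)%N.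
  rewrite [in RHS](eq_bigl (fun i => (i \in V) && (i != y))); last first.
    by move=> i; rewrite !inE andbC.
  rewrite -big_split; apply: eq_bigr => i _ /=.
  rewrite (bigD1 y) //= addnC e_sym; congr (_ + _)%N.
  by apply: eq_bigl => j; rewrite !inE andbC.
have : (\sum_(i in V | i != y) e y i = 1)%N.
  by rewrite -sumy [in RHS](bigD1 y) //= e_irr.
by move=> ->; rewrite addn1 add1n.
Qed.

End FiniteTrees.

(** * Sums over words of fixed length, and occurrence counts *)

Section Words.
Variable A : finType.
Implicit Types (u v w z : seq A) (a b : A).

(** The summand takes sequences, so that one [F] serves all lengths and no casts between tuple types
    arise. *)
Definition word_sum n (F : seq A -> int) : int := \sum_(t : n.-tuple A) F t.

Lemma word_sum0 F : word_sum 0 F = F [::].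
Proof.
rewrite /word_sum (bigD1 [tuple]) //= big1 ?addr0 // => t.
by case/eqP; apply: tuple0.
Qed.

Lemma word_sum_cons n F :
  word_sum n.+1 F = word_sum n (fun w => \sum_a F (a :: w)).
Proof.
rewrite /word_sum exchange_big pair_big /=.
rewrite (reindex (fun p : A * n.-tuple A => [tuple of p.1 :: p.2])) //=.
exists (fun t => (thead t, [tuple of behead t])) => [[a t] _|t _].
  by congr pair; apply: val_inj.
by case/tupleP: t => a t; apply: val_inj.
Qed.

Lemma word_sum_rcons n F :
  word_sum n.+1 F = word_sum n (fun w => \sum_a F (rcons w a)).
Proof.
elim: n F => [|n IHn] F.
  by rewrite word_sum_cons !word_sum0.
rewrite word_sum_cons IHn [RHS]word_sum_cons; apply: eq_bigr => t _.
by rewrite exchange_big.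
Qed.

Lemma eq_word_sum n F G :
  (forall w, size w = n -> F w = G w) -> word_sum n F = word_sum n G.
Proof. by move=> FG; apply: eq_bigr => t _; rewrite FG ?size_tuple. Qed.

Lemma le_word_sum n F G :
  (forall w, size w = n -> F w <= G w) -> word_sum n F <= word_sum n G.
Proof. by move=> FG; apply: ler_sum => t _; rewrite FG ?size_tuple. Qed.

Lemma word_sumD n F G :
  word_sum n (fun w => F w + G w) = word_sum n F + word_sum n G.
Proof. exact: big_split. Qed.

Lemma word_sum_eq0 n (Q : pred (seq A)) :
  word_sum n (fun w => if Q w then 1 else 0) = 0 ->
  forall w, size w = n -> ~~ Q w.
Proof.
move=> S0 w /eqP sw; apply/negP => Qw; have := S0.
rewrite /word_sum (bigD1 (Tuple sw)) //= Qw => /eqP; apply/negP.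
by rewrite gt_eqF // ltr_pwDl // sumr_ge0 // => t _; case: ifP.
Qed.

Lemma word_sum_prefix w k F :
  word_sum (size w + k) (fun v => if prefix w v then F v else 0) =
  word_sum k (fun u => F (w ++ u)).
Proof.
elim: w F => [|c w IHw] F; first by apply: eq_word_sum => v _; rewrite prefix0s.
rewrite addSn word_sum_cons -(IHw (fun v => F (c :: v))).
apply: eq_word_sum => v _.
rewrite (bigD1 c) //= eqxx big1 ?addr0 // => a.
by rewrite eq_sym => /negPf ->.
Qed.

Lemma finite_words (Q : pred (seq A)) n : exists s : seq (seq A),
  [/\ uniq s, forall u, (u \in s) = Q u && (size u < n)%N &
      (size s)%:Z = \sum_(k < n) word_sum k (fun u => if Q u then 1 else 0)].
Proof.
elim: n => [|n [s [us sP ss]]].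
  by exists [::]; split=> [//|u|]; [rewrite andbF|rewrite big_ord0].
pose s' := [seq tval t | t <- enum [pred t : n.-tuple A | Q t]].
have s'P u : (u \in s') = Q u && (size u == n).
  apply/mapP/andP => [[t]|[Qu su]].
    by rewrite mem_enum inE => Qt ->; rewrite size_tuple eqxx.
  by exists (Tuple su) => //; rewrite mem_enum inE.
exists (s ++ s'); split.
- rewrite cat_uniq us (map_inj_uniq val_inj) enum_uniq andbT.
  apply/hasPn => u; rewrite s'P => /andP[_ /eqP su].
  by rewrite /= sP su ltnn andbF.
- by move=> u; rewrite mem_cat sP s'P -andb_orr ltnS orbC -leq_eqVlt.
- rewrite size_cat PoszD ss big_ord_recr /=; congr (_ + _).
  by rewrite /word_sum -big_mkcond sumr_const size_map -cardE natz.
Qed.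

Lemma n_occ_cons w a v : n_occ w (a :: v) = (prefix w (a :: v) + n_occ w v)%N.
Proof.
have countS (P : pred nat) n :
    count P (iota 0 n.+1) = (P 0 + count (P \o S) (iota 0 n))%N.
  by rewrite /= (iotaDl 1 0) count_map.
rewrite /n_occ [LHS]countS prefixE; congr (_ + _)%N.
(* At position 0 the length condition follows from the equality of [take] with [w]. *)
rewrite add0n drop0; congr nat_of_bool; case: eqP => [E|]; last by rewrite andbF.
by rewrite andbT -[in LHS]E size_take geq_minr.
Qed.

Lemma n_occ_nil w : n_occ w [::] = (w == [::]).
Proof. by rewrite /n_occ /=; case: w. Qed.

Lemma n_occ_gt0 w v : (0 < n_occ w v)%N = infix w v.
Proof.
elim: v => [|a v IHv]; first by rewrite n_occ_nil; case: w.
by rewrite n_occ_cons infix_consl addn_gt0 IHv lt0b.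
Qed.

Lemma prefix_rconsE w v b :
  prefix w (rcons v b) = prefix w v || (w == rcons v b).
Proof.
elim: v w => [|c v IHv] [|d w] //=.
by rewrite IHv eqseq_cons -andb_orr.
Qed.

Lemma suffix_consE w a v : suffix w (a :: v) = suffix w v || (w == a :: v).
Proof.
rewrite /suffix rev_cons prefix_rconsE -rev_cons; congr (_ || _).
by rewrite (inj_eq (can_inj revK)).
Qed.

Lemma n_occ_rcons w v b :
  n_occ w (rcons v b) = (n_occ w v + suffix w (rcons v b))%N.
Proof.
elim: v => [|a v IHv]; first rewrite n_occ_cons n_occ_nil addnC.
  by rewrite suffix_consE (prefix_rconsE _ [::]) prefixs0 suffixs0.
rewrite rcons_cons !n_occ_cons IHv -rcons_cons prefix_rconsE rcons_cons suffix_consE.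
(* If [w] is the whole word, its single occurrence is a prefix for one recursion and a suffix for
   the other; the shorter words cannot contain it. *)
have [E|_] := eqVneq w (a :: rcons v b); last by rewrite !orbF addnA.
have -> : prefix w (a :: v) = false.
  by apply/negP => /size_prefix; rewrite E /= size_rcons ltnn.
have -> : suffix w (rcons v b) = false.
  by apply/negP => /size_suffix; rewrite E /= ltnn.
by rewrite /= addn0 addnC.
Qed.

Lemma n_occ_catr w v z : (n_occ w z <= n_occ w (v ++ z))%N.
Proof. by elim: v => //= a v IHv; rewrite n_occ_cons (leq_trans IHv) ?leq_addl. Qed.

Lemma n_occ_id w : n_occ w w = 1%N.
Proof.
case: w => [|a w]; first by rewrite n_occ_nil.
rewrite n_occ_cons prefix_refl; apply/eqP; rewrite eqSS -leqn0 leqNgt n_occ_gt0.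
by apply/negP => /size_infix; rewrite /= ltnn.
Qed.

End Words.

(** A nonzero term is an integer, hence at least 1; infinitely many of them would exceed any
    bound. *)
Lemma summable_nat_eventually0 (f : nat -> int) (B : int) :
  (forall k, 0 <= f k) -> (forall n, \sum_(k < n) f k <= B) ->
  exists K, forall k, (K <= k)%N -> f k = 0.
Proof.
move=> f0 fB; case: (decPP (exists K, forall k, (K <= k)%N -> f k = 0)) => // noK.
have inf n : exists2 k, (n <= k)%N & 0 < f k.
  case: (decPP (exists2 k, (n <= k)%N & 0 < f k)) => // nok.
  case: noK; exists n => k nk; apply/eqP; rewrite eq_le f0 andbT leNgt.
  by apply/negP => fk; case: nok; exists k.
have mono n k : (n <= k)%N -> \sum_(i < n) f i <= \sum_(i < k) f i.
  move=> /subnK <-; elim: (k - n)%N => // d IHd.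
  by rewrite addSn big_ord_recr /= (le_trans IHd) // lerDl.
have unbounded N : exists n, N%:Z <= \sum_(k < n) f k.
  elim: N => [|N [n Nn]]; first by exists 0%N; rewrite big_ord0.
  have [k nk fk] := inf n; exists k.+1; rewrite big_ord_recr /=.
  by rewrite -addn1 PoszD lerD // (le_trans Nn) // mono.
have [n /le_trans/(_ (fB n))] := unbounded (absz B).+1; lia.
Qed.

(** * Language of a shift and its extension graphs *)

Section Language.
Variables (A : finType) (X : config A -> Prop).
Implicit Types (u v w z : seq A) (a b : A).

Lemma lang_catl u v : lang X (u ++ v) -> lang X u.
Proof.
case=> x [Xx [i E]]; exists x; split=> //; exists i.
move: E; rewrite size_cat iotaD map_cat => /eqP.
by rewrite eqseq_cat ?size_map ?size_iota // => /andP[/eqP].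
Qed.

Lemma lang_catr u v : lang X (u ++ v) -> lang X v.
Proof.
case=> x [Xx [i E]]; exists x; split=> //; exists (i + (size u)%:Z).
move: E; rewrite size_cat iotaD map_cat => /eqP.
rewrite eqseq_cat ?size_map ?size_iota // => /andP[_ /eqP].
rewrite add0n -[X in iota X](addn0 (size u)) iotaDl -map_comp => E.
by rewrite -[RHS]E; apply: eq_map => k /=; rewrite PoszD addrA.
Qed.

Lemma lang_infix u v : infix u v -> lang X v -> lang X u.
Proof. by case/infixP=> s [s' ->] /lang_catr/lang_catl. Qed.

Lemma lang_rconsW u b : lang X (rcons u b) -> lang X u.
Proof. by rewrite -cats1; apply: lang_catl. Qed.

Lemma lang_consW a u : lang X (a :: u) -> lang X u.
Proof. by rewrite -cat1s; apply: lang_catr. Qed.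

Lemma lang_extend_right u : lang X u -> exists b, lang X (rcons u b).
Proof.
case=> x [Xx [i E]]; exists (x (i + (size u)%:Z)), x; split=> //; exists i.
by rewrite size_rcons -addn1 iotaD map_cat E add0n cats1.
Qed.

Lemma lang_extend_right_size u n :
  lang X u -> exists2 v, size v = n & lang X (u ++ v).
Proof.
move=> Lu; elim: n => [|n [v sv Luv]]; first by exists [::]; rewrite ?cats0.
have [b Lb] := lang_extend_right Luv.
by exists (rcons v b); rewrite ?size_rcons ?sv // -rcons_cat.
Qed.

Lemma card_R1 u : #|R1 X u| = (\sum_b decP (lang X (rcons u b)))%N.
Proof.
rewrite -sum1_card big_mkcond; apply: eq_bigr => b _.
by rewrite inE; case: decPP.
Qed.

(** This is edges + 1 = vertices for the extension graph of [w], read as a boolean graph on the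
    finite type [A + A]. *)
Lemma dendric_extension_count w : lang X w ->
  is_tree (ext_vertex X w) (ext_edge X w) ->
  ((\sum_a \sum_b decP (lang X (a :: rcons w b))).+1 =
   \sum_a decP (lang X (a :: w)) + #|R1 X w|)%N.
Proof.
move=> Lw [conn acyc].
pose V := [set v | decP (ext_vertex X w v)].
pose e := [rel u v | decP (ext_edge X w u v)].
have eC (p q : A + A) : e p q -> e q p.
  move=> /decPP[Vp [Vq E]]; apply/decPP; split=> //; split=> //.
  by case: p q E {Vp Vq} => [a|a] [b|b].
have e_sym : symmetric e by move=> u v; apply/idP/idP; apply: eC.
have e_irr : irreflexive e.
  by move=> u; apply/negP => /decPP[_ [_]]; case: u.
have e_acyc c : uniq c -> (3 <= size c)%N -> ~~ cycle e c.
  move=> uc sc; apply/negP => cc; apply: acyc.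
  case: c uc sc cc => // x c uc sc /(pathP x) cc; exists (x :: c), x; split=> //; split=> // i.
  rewrite /= ltnS => lei; have := cc i; rewrite size_rcons ltnS => /(_ lei) /decPP.
  rewrite -rcons_cons !nth_rcons /= ltnS lei; case: ltngtP lei => // [lti|->] _.
    by rewrite modn_small.
  by rewrite modnn.
have V0 : V != set0.
  have [b Lb] := lang_extend_right Lw.
  by apply/set0Pn; exists (inr b); rewrite inE; apply/decPP.
have := tree_edge_count e_sym e_irr e_acyc V0.
have -> : #|V| = (\sum_a decP (lang X (a :: w)) + #|R1 X w|)%N.
  rewrite card_R1 -sum1_card big_mkcond big_sumType /=.
  by congr (_ + _)%N; apply: eq_bigr => a _; rewrite inE; case: decPP.
(* The graph is bipartite: left-right and right-left pairs each count all edges, pairs on one side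
   none. *)
have -> : (\sum_(x in V) \sum_(y in V) e x y =
           (\sum_a \sum_b decP (lang X (a :: rcons w b))).*2)%N.
  have -> : (\sum_(x in V) \sum_(y in V) e x y = \sum_x \sum_y e x y)%N.
    rewrite big_mkcond; apply: eq_bigr => x _; rewrite inE.
    case: decPP => [_|nVx]; last first.
      by rewrite big1 // => y _ /=; case: decPP => // -[].
    rewrite big_mkcond; apply: eq_bigr => y _; rewrite inE /=.
    by case: decPP => // nVy; case: decPP => // -[_ []].
  have lr a b : e (inl a) (inr b) = decP (lang X (a :: rcons w b)).
    apply/decPP/decPP => [[_ []] //|L]; split; last split => //=.
      by move: L; rewrite -rcons_cons => /lang_rconsW.
    exact: lang_consW L.
  have ll a b : e (inl a) (inl b) = false by apply/decPP => -[_ []].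
  have rr a b : e (inr a) (inr b) = false by apply/decPP => -[_ []].
  rewrite big_sumType -addnn; congr (_ + _)%N.
    apply: eq_bigr => a _; rewrite big_sumType /= big1 ?add0n.
      by apply: eq_bigr => b _; rewrite -lr.
    by move=> b _; rewrite -[decP _]/(e _ _) ll.
  rewrite [RHS]exchange_big; apply: eq_bigr => b _; rewrite big_sumType /= addnC big1 ?add0n.
    by apply: eq_bigr => a _; rewrite -lr; congr nat_of_bool; apply: e_sym.
  by move=> a _; rewrite -[decP _]/(e _ _) rr.
rewrite -doubleS => h; apply: double_inj; apply: h => u v.
rewrite !inE => /decPP Vu /decPP Vv.
have := conn _ _ Vu Vv; elim=> [x y E|x|x y z _ xy _ yz].
- by apply: connect1 => /=; rewrite !inE; case: (E) => Vx [Vy _]; apply/and3P; split; apply/decPP.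
- exact: connect0.
- exact: connect_trans xy yz.
Qed.

(** Outside the language [rho] would be -1; the value 0 allows sums over all words of a given
    length. *)
Definition lang_rho u : int := if decP (lang X u) then rho X u else 0.

Lemma lang_rho_ge0 u : 0 <= lang_rho u.
Proof.
rewrite /lang_rho; case: decPP => // /lang_extend_right[b Lb].
rewrite subr_ge0 lez_nat card_gt0; apply/set0Pn; exists b.
by rewrite inE; apply/decPP.
Qed.

(** * Conservation of [rho] above the threshold *)

Section Dendric.
Variable m : nat.
Hypothesis dendric : eventually_dendric X m.

(** The left side is the number of edges of the extension graph minus the number of its left
    vertices. In a tree this is the number of right vertices minus one. *)
Lemma sum_lang_rho_cons w : (m <= size w)%N ->
  \sum_a lang_rho (a :: w) = lang_rho w.
Proof.
move=> mw; rewrite {2}/lang_rho; case: decPP => [Lw|nLw]; last first.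
  by rewrite big1 // => a _; rewrite /lang_rho; case: decPP => // /lang_consW.
have := dendric_extension_count Lw (dendric Lw mw).
have -> : \sum_a lang_rho (a :: w) =
   \sum_a ((\sum_b decP (lang X (a :: rcons w b)))%N%:Z - (decP (lang X (a :: w)))%:Z).
  apply: eq_bigr => a _; rewrite /lang_rho /rho card_R1; case: (decPP (lang X (a :: w))) => //.
  move=> nL; rewrite big1 // => b _; case: decPP => // L; case: nL.
  exact: (@lang_rconsW (a :: w) b).
rewrite sumrB /rho -!(big_morph Posz PoszD (erefl _)) => E.
by rewrite -addn1 in E; move/(congr1 Posz): E; rewrite !PoszD; lia.
Qed.

Lemma word_sum_lang_rho n : (m <= n)%N -> word_sum n lang_rho = rho_Lm X m.
Proof.
move=> /subnK <-; elim: (n - m)%N => [|d IHd].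
  by rewrite /rho_Lm [RHS]big_mkcond.
rewrite addSn word_sum_cons -IHd; apply: eq_word_sum => w sw.
by rewrite sum_lang_rho_cons // sw leq_addl.
Qed.

Hypothesis irred : irreducible X.

(** * Counting open words and return words to [w] *)

Section Returns.
Variable w : seq A.
Hypotheses (Lw : lang X w) (mw : (m <= size w)%N).

(** Words starting with [w] are indexed by their tail [u], and the level is the length of [u]. Thus
    [open_count k] and [return_count k] are the numbers o_k and r_k. *)
Let first u := n_occ w (w ++ u) == 1%N.
Let infix_rho n := word_sum n (fun z => if infix w z then lang_rho z else 0).
Let first_rho k := word_sum k (fun u => if first u then lang_rho (w ++ u) else 0).
Let open_count k :=
  word_sum k (fun u => if decP (lang X (w ++ u)) && first u then 1 else 0).
Let return_count k := word_sum k (fun u => if decP (return_word X w u) then 1 else 0).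

(** Among words of its own length, only [w] contains [w]. *)
Lemma infix_rho_base : infix_rho (size w) = first_rho 0.
Proof.
rewrite /first_rho -(word_sum_prefix w 0 (fun v => if n_occ w v == 1%N then lang_rho v else 0)).
rewrite addn0; apply: eq_word_sum => z sz.
have -> : prefix w z = (w == z).
  by rewrite prefixE -sz take_size eq_sym.
have -> : infix w z = (w == z).
  apply/idP/eqP => [/infixP[s [s' E]]|-> //]; last exact: infix_refl.
  move: sz; rewrite E !size_cat => sz.
  have: (size s + size s' == 0)%N by rewrite -(eqn_add2l (size w)) addn0 addnCA sz.
  by rewrite addn_eq0 => /andP[/nilP -> /nilP ->]; rewrite cats0.
by case: eqP => // <-; rewrite n_occ_id.
Qed.

(** Sort the words [a :: z] by whether [z] contains [w]. If so, summing over [a] gives back the term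
    of [z], and no [a :: z] has [w] only as a prefix. If not, [a :: z] contains [w] exactly when it
    starts with it, and then only once. *)
Lemma infix_rho_step k : infix_rho (size w + k).+1 = infix_rho (size w + k) + first_rho k.+1.
Proof.
rewrite /first_rho -(word_sum_prefix w k.+1 (fun v => if n_occ w v == 1%N then lang_rho v else 0)).
rewrite addnS /infix_rho !word_sum_cons -word_sumD; apply: eq_word_sum => z sz.
have [wz|wz] := boolP (infix w z).
  rewrite [X in _ + X]big1 => [|a _]; last first.
    case: ifP => // p; rewrite n_occ_cons p; move: wz; rewrite -n_occ_gt0.
    by case: n_occ.
  rewrite addr0 -sum_lang_rho_cons; last by rewrite sz; lia.
  by apply: eq_bigr => a _; rewrite infix_consl wz orbT.
rewrite add0r; apply: eq_bigr => a _; rewrite infix_consl (negPf wz) orbF.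
case: ifP => // p; rewrite n_occ_cons p.
by move: wz; rewrite -n_occ_gt0 lt0n negbK => /eqP ->.
Qed.

Lemma return_word_rcons u b : return_word X w (rcons u b) <->
  [/\ lang X (rcons (w ++ u) b), first u & suffix w (rcons (w ++ u) b)].
Proof.
rewrite /return_word /complete_return -rcons_cat n_occ_rcons /first; split.
  by case=> L [+ [_ [s _]]]; rewrite s addn1 => -[->].
case=> L /eqP -> s; rewrite s; split=> //; split=> //; split.
  by rewrite rcons_cat prefix_prefix.
by split=> //; rewrite size_rcons size_cat ltnS leq_addr.
Qed.

Lemma not_return_word_nil : ~ return_word X w [::].
Proof. by rewrite /return_word cats0 => -[_ [_ [_ []]]]; rewrite ltnn. Qed.

Lemma open_count_step k : open_count k.+1 + return_count k.+1 = open_count k + first_rho k.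
Proof.
rewrite /open_count /return_count !word_sum_rcons -!word_sumD; apply: eq_word_sum => u _.
rewrite -big_split /=.
transitivity (\sum_b (first u && decP (lang X (rcons (w ++ u) b)))%N%:Z).
  apply: eq_bigr => b _; rewrite -rcons_cat.
  case: (decPP (return_word _ _ _)) => [/return_word_rcons[L f s]|nr].
    rewrite f; case: decPP => // _; rewrite {1}/first -rcons_cat n_occ_rcons s.
    by move: f; rewrite /first => /eqP ->.
  case: decPP => L; last by rewrite andbF.
  rewrite andbT /= addr0 {1}/first -rcons_cat n_occ_rcons.
  have [s|] := boolP (suffix _ _); last by rewrite addn0 /first; case: eqP.
  have [f|_] := boolP (first u); first by case: nr; apply/return_word_rcons.
  (* The prefix [w] and the new suffix [w] are two occurrences, so the longer word is not open. *)
  have: (0 < n_occ w (w ++ u))%N by rewrite n_occ_gt0 prefix_infix.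
  by rewrite addn1; case: n_occ.
case: (first u); last by rewrite andbF addr0 big1.
rewrite andbT -(big_morph Posz PoszD (erefl _)) -card_R1 /lang_rho.
case: decPP => L; first by rewrite /rho addrC subrK.
rewrite card_R1 big1 // => b _; case: decPP => // /lang_rconsW //.
Qed.

Lemma return_count_partial_sum K :
  \sum_(k < K.+2) return_count k + open_count K.+1 = 1 + infix_rho (size w + K).
Proof.
(* Level 0 has no return word, so the sum over [K.+2] levels is r_1 + ... + r_(K+1). *)
have c0 : return_count 0 = 0.
  by rewrite /return_count word_sum0; case: decPP => // /not_return_word_nil.
elim: K => [|K IHK].
  rewrite !big_ord_recr big_ord0 /= c0 !add0r addrC open_count_step addn0 infix_rho_base.
  rewrite /open_count word_sum0 /first cats0 n_occ_id eqxx andbT.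
  by case: decPP.
rewrite big_ord_recr /= -addrA [return_count _ + _]addrC open_count_step addrA IHK.
by rewrite addnS infix_rho_step addrA.
Qed.

Lemma infix_rho_le K : infix_rho (size w + K) <= rho_Lm X m.
Proof.
rewrite -(@word_sum_lang_rho (size w + K)); last by lia.
by apply: le_word_sum => z _; case: ifP => // _; apply: lang_rho_ge0.
Qed.

(** Read [q] letter by letter: the first letter that completes a new occurrence of [w] ends a
    complete return word. *)
Lemma first_closes u q : lang X (w ++ u ++ q) -> first u ->
  (1 < n_occ w (w ++ u ++ q))%N ->
  exists2 u', return_word X w u' & (size u < size u')%N.
Proof.
elim: q u => [|b q IHq] u; first by rewrite cats0 /first => _ /eqP ->.
rewrite -cat_rcons => L f n2.
have [s|ns] := boolP (suffix w (rcons (w ++ u) b)).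
  exists (rcons u b); last by rewrite size_rcons.
  apply/return_word_rcons; split=> //.
  by move: L; rewrite catA => /lang_catl; rewrite -rcons_cat.
have [|u' r su'] := IHq (rcons u b) L _ n2.
  by rewrite /first -rcons_cat n_occ_rcons (negPf ns) addn0.
by exists u' => //; move: su'; rewrite size_rcons; apply: ltn_trans.
Qed.

(** Delete letters of [y] from the left until the last occurrence of [w] is a prefix; the open word
    left over still ends with [z]. *)
Lemma last_occurrence y z : lang X (y ++ z) -> ~~ infix w z -> infix w (y ++ z) ->
  exists u, [/\ lang X (w ++ u), first u & (size z <= size w + size u)%N].
Proof.
move=> + nz; elim: y => [|a y IHy]; first by rewrite /= (negPf nz).
rewrite cat_cons => L; rewrite infix_consl.
have [yz _|nyz] := boolP (infix w (y ++ z)); first by apply: IHy => //; apply: lang_consW L.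
rewrite orbF => p; case/prefixP: (p) => u E; exists u; split; first by rewrite -E.
  rewrite /first -E n_occ_cons p; move: nyz.
  by rewrite -n_occ_gt0 lt0n negbK => /eqP ->.
by rewrite -size_cat -E /= size_cat; lia.
Qed.

Lemma return_bound : exists K,
  [/\ forall u, return_word X w u -> (size u < K)%N,
      forall u, lang X (w ++ u) -> first u -> (size u < K)%N &
      forall z, lang X z -> (size w + K <= size z)%N -> infix w z].
Proof.
have [K return_count0] : exists K, forall k, (K <= k)%N -> return_count k = 0.
  have return_count_ge0 k : 0 <= return_count k by apply: sumr_ge0 => t _; case: ifP.
  have open_count_ge0 k : 0 <= open_count k by apply: sumr_ge0 => t _; case: ifP.
  apply: (@summable_nat_eventually0 _ (1 + rho_Lm X m)) => // n.
  apply: (@le_trans _ _ (\sum_(k < n.+2) return_count k)).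
    by rewrite !big_ord_recr /= -addrA lerDl addr_ge0.
  apply: (@le_trans _ _ (1 + infix_rho (size w + n))); last by rewrite lerD2l infix_rho_le.
  by rewrite -return_count_partial_sum lerDl.
have retK u : return_word X w u -> (size u < K)%N.
  move=> ru; rewrite ltnNge; apply/negP => /return_count0 c0.
  have := @word_sum_eq0 _ _ (fun v => decP (return_word X w v)) c0 u erefl.
  by case: decPP.
have firstK u : lang X (w ++ u) -> first u -> (size u < K.+1)%N.
  (* Irreducibility puts a further [w] on the right. As [a :: u] is nonempty, it starts later than
     the prefix [w], even if [w] is empty. *)
  case: u => // a u L f; have [s Ls] := irred L Lw.
  move: Ls; rewrite -catA => Ls.
  have [|u' /retK] := first_closes Ls f; last by lia.
  have: prefix w (w ++ (a :: u) ++ s ++ w) by exact: prefix_prefix.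
  rewrite [w ++ (a :: u) ++ s ++ w]catA.
  case E: (w ++ a :: u) => [|c y]; first by case: (w) E.
  rewrite cat_cons n_occ_cons => ->; rewrite ltnS.
  by apply: leq_trans (n_occ_catr w y (s ++ w)); apply: leq_trans (n_occ_catr w s w); rewrite n_occ_id.
exists K.+1; split=> // [u /retK|z Lz Kz]; first by move/ltnW.
(* If [z] avoided [w], the last occurrence of [w] in [w ++ s ++ z] would start an open word at least
   as long as [z], against [firstK]. *)
have [s Ls] := irred Lw Lz; apply/negPn/negP => nz.
have [||u [Lu f]] := @last_occurrence (w ++ s) z _ nz.
- by rewrite -catA.
- by rewrite -catA prefix_infix.
by have := firstK _ Lu f; lia.
Qed.

Lemma card_return_words : exists s : seq (seq A),
  [/\ uniq s, forall u, return_word X w u <-> u \in s &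
      (size s)%:Z = 1 + rho_Lm X m].
Proof.
have [K [retK firstK infixK]] := return_bound.
(* The bound [K.+2] matches the range of the sum in [return_count_partial_sum]. *)
have [s [us sP ss]] := finite_words (fun u => decP (return_word X w u)) K.+2.
exists s; split=> // [u|].
  rewrite sP; split=> [r|/andP[/decPP //]].
  by apply/andP; split; [apply/decPP|move: (retK _ r); lia].
have open_count0 : open_count K.+1 = 0.
  apply: big1 => t _; case: decPP => //= L; case: ifP => // f.
  by have := firstK _ L f; rewrite size_tuple; lia.
have := return_count_partial_sum K; rewrite open_count0 addr0 => sumE.
rewrite ss [LHS]sumE; congr (_ + _).
rewrite -(@word_sum_lang_rho (size w + K)); last by lia.
apply: eq_word_sum => z sz; case: ifP => // nz; rewrite /lang_rho; case: decPP => // L.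
by rewrite infixK ?sz in nz.
Qed.

End Returns.

(** Prolong [w] to a word [w ++ v] of length at least [m]: every long word of the language contains
    it, hence contains [w]. A complete return word to [w] stripped of its first and last letters
    avoids [w], so it is short. *)
Lemma finite_return_words w : lang X w ->
  exists s : seq (seq A), forall u, return_word X w u <-> u \in s.
Proof.
move=> Lw; have [v sv Lwv] := lang_extend_right_size m Lw.
have [|K [_ _ infixK]] := return_bound Lwv; first by rewrite size_cat sv leq_addl.
set N := (size (w ++ v) + K)%N in infixK.
(* The 2 accounts for the two stripped letters. *)
have [s [_ sP _]] := finite_words (fun u => decP (return_word X w u)) N.+2.
exists s => u; rewrite sP; split=> [r|/andP[/decPP //]].
apply/andP; split; first exact/decPP.
case/lastP: u r => // u b /return_word_rcons[L /eqP f _].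
case E: (w ++ u) f L => [|a y] f L.
  by have := congr1 size E; rewrite size_cat size_rcons /=; lia.
have := congr1 size E; rewrite size_cat size_rcons /= => sE.
suff: (size y < N)%N by lia.
rewrite ltnNge; apply/negP => Ny.
have Ly : lang X y by move: L => /lang_rconsW/lang_consW.
have := catr_infix (infixK y Ly Ny); rewrite -n_occ_gt0.
move: f; rewrite n_occ_cons -E prefix_prefix; lia.
Qed.

End Dendric.
End Language.

Theorem mainTheorem12 (A : finType) (X : config A -> Prop) (m : nat) :
  shift_space X -> irreducible X -> eventually_dendric X m ->
  (forall w : seq A, lang X w ->
     exists s : seq (seq A), forall u, return_word X w u <-> u \in s) /\
  (forall w : seq A, lang X w -> (m <= size w)%N ->
     exists s : seq (seq A),
       uniq s /\ (forall u, return_word X w u <-> u \in s) /\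
       (size s)%:Z = 1 + rho_Lm X m).
Proof.
move=> _ irr dend; split=> [w Lw|w Lw mw]; first exact: finite_return_words dend irr _ Lw.
by have [s [us sP ss]] := card_return_words dend irr Lw mw; exists s.
Qed.
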